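(* Let $A$ be a finitely generated commutative $\mathbb{R}$-algebra with $1$. For any set $\mathcal{Y}$ of semiorderings of $A$, $$\Big(\bigcap_{Q\in\mathcal{Y}}Q\Big)^{\ddagger}=\overline{\bigcap_{Q\in\mathcal{Y}}Q}=\bigcap_{Q\in\mathcal{Y}}\overline{Q}.$$
   Context: A quadratic module of $A$ is a subset $Q\subseteq A$ with $Q+Q\subseteq Q$, $f^2Q\subseteq Q$ for all $f\in A$, and $1\in Q$. A semiordering of $A$ is a quadratic module $Q$ of $A$ such that $Q\cup -Q=A$ and $Q\cap -Q$ is a prime ideal of $A$. $A$ is endowed, as a real vector space, with the finest locally convex topology (the vector space topology for which all convex, absorbent, symmetric subsets form a zero neighborhood base; $U$ is absorbent if for each $x$ there is $\lambda>0$ with $x\in\lambda U$, and symmetric if $\lambda U\subseteq U$ for all $|\lambda|\le 1$). For $C\subseteq A$, $\overline{C}$ is the closure of $C$ in this topology, and $C^{\ddagger}$ (the sequential closure) is the set of all elements of $A$ that are limits of sequences of elements of $C$. An intersection over the empty family is understood to be $A$. *)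

(* Defs.v *)
From HB Require Import structures.
From mathcomp Require Import all_boot all_order all_algebra.
From mathcomp Require Import all_classical all_reals all_analysis.

Set Implicit Arguments.
Unset Strict Implicit.
Unset Printing Implicit Defensive.

Import Order.TTheory GRing.Theory Num.Theory.
Import numFieldNormedType.Exports.

Local Open Scope classical_set_scope.
Local Open Scope ring_scope.

Definition absorbent (R : realType) (V : lmodType R) (U : set V) : Prop :=
  forall x, exists2 l : R, 0 < l & [set l *: u | u in U] x.

Definition symmetric_set (R : realType) (V : lmodType R) (U : set V) : Prop :=
  forall l : R, `|l| <= 1 -> [set l *: u | u in U] `<=` U.

Definition convex_absorbent_symmetric (R : realType) (V : lmodType R)
    (U : set V) : Prop :=
  [/\ convex_set U, absorbent U & symmetric_set U].

Definition flc_nbhs (R : realType) (V : lmodType R) (x : V) : set_system V :=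
  [set A | exists2 U, convex_absorbent_symmetric U & [set x + u | u in U] `<=` A].

(* V itself; the alias keys the finest locally convex topology, since an
   lmodType has no canonical one. *)
Definition flc (R : realType) (V : lmodType R) : Type := V.

HB.instance Definition _ (R : realType) (V : lmodType R) :=
  GRing.Lmodule.on (flc V).
HB.instance Definition _ (R : realType) (V : lmodType R) :=
  hasNbhs.Build (flc V) (@flc_nbhs R V).

Section flc_topology.
Variables (R : realType) (V : lmodType R).
Implicit Types (U W : set V) (x y : V) (A : set V).
Local Notation cas := (@convex_absorbent_symmetric R V).

(* The inverse of the scalar in [absorbent] turns x = l *: u into U (l^-1 *: x). *)
Lemma casP U : cas U <->
  [/\ forall x y (t : R), 0 <= t -> t <= 1 -> U x -> U y ->
        U (t *: x + (1 - t) *: y),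
      forall x, exists2 l : R, 0 < l & U (l *: x) &
      forall (l : R) x, `|l| <= 1 -> U x -> U (l *: x)].
Proof.
split=> [[cU aU sU]|[cU aU sU]].
- split.
  + move=> x y t t0 t1 Ux Uy.
    have t01 : t \in `[0, 1] by rewrite in_itv/= t0.
    by have := cU x y (Itv01 t0 t1); rewrite !inE; exact.
  + move=> x; have [l l0 [u Uu <-]] := aU x.
    exists l^-1; first by rewrite invr_gt0.
    by rewrite scalerA mulVf ?gt_eqF// scale1r.
  + by move=> l x l1 Ux; apply: (sU l l1); exists x.
- split.
  + move=> x y t; rewrite !inE => Ux Uy.
    by apply: cU => //.
  + move=> x; have [l l0 Ux] := aU x.
    exists l^-1; first by rewrite invr_gt0.
    by exists (l *: x) => //; rewrite scalerA mulVf ?gt_eqF// scale1r.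
  + by move=> l l1 _ [x Ux <-]; exact: sU.
Qed.

Lemma cas0 U : cas U -> U 0.
Proof.
move=> /casP[_ aU sU]; have [l _ Ul] := aU 0.
by rewrite scaler0 in Ul.
Qed.

Lemma casT : cas [set: V].
Proof. by apply/casP; split=> // x; exists 1. Qed.

Lemma casI U W : cas U -> cas W -> cas (U `&` W).
Proof.
move=> /casP[cU aU sU] /casP[cW aW sW]; apply/casP; split.
- by move=> x y t t0 t1 [Ux Wx] [Uy Wy]; split; [exact: cU|exact: cW].
- move=> x; have [l l0 Ul] := aU x; have [m m0 Wm] := aW x.
  wlog lm : U W cU aU sU cW aW sW l m l0 m0 Ul Wm / l <= m.
    move=> H; have [lm|/ltW ml] := leP l m; first exact: (H U W _ _ _ _ _ _ l m).
    by rewrite setIC; apply: (H W U _ _ _ _ _ _ m l).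
  exists l => //; split=> //.
  rewrite (_ : l *: x = (l / m) *: (m *: x)); last first.
    by rewrite scalerA divfK ?gt_eqF.
  apply: sW => //; rewrite ger0_norm ?(divr_ge0 (ltW l0) (ltW m0))//.
  by rewrite ler_pdivrMr ?mul1r.
- by move=> l x l1 [Ux Wx]; split; [exact: sU|exact: sW].
Qed.

Lemma cas_scale (c : R) U : 0 < c -> cas U -> cas [set c *: u | u in U].
Proof.
move=> c0 /casP[cU aU sU]; apply/casP; split.
- move=> _ _ t t0 t1 [x Ux <-] [y Uy <-].
  exists (t *: x + (1 - t) *: y); first exact: cU.
  by rewrite scalerDr !scalerA ![c * _]mulrC.
- move=> x; have [l l0 Ul] := aU x; exists (c * l); first exact: mulr_gt0.
  by exists (l *: x); rewrite ?scalerA.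
- move=> l _ l1 [x Ux <-]; exists (l *: x); first exact: sU.
  by rewrite !scalerA mulrC.
Qed.

Lemma cas_add U (s t : R) x y : cas U -> 0 <= s -> 0 <= t -> s + t <= 1 ->
  U x -> U y -> U (s *: x + t *: y).
Proof.
move=> casU s0 t0 st1 Ux Uy; have /casP[cU aU sU] := casU.
have [st0|st0] := eqVneq (s + t) 0.
  move: st0 => /eqP; rewrite paddr_eq0// => /andP[/eqP-> /eqP->].
  by rewrite !scale0r addr0; exact: cas0.
have stgt : 0 < s + t by rewrite lt_neqAle eq_sym st0 addr_ge0.
rewrite (_ : _ + _ =
  (s + t) *: ((s / (s + t)) *: x + (1 - s / (s + t)) *: y)); last first.
  rewrite scalerDr !scalerA mulrBr mulr1 mulrCA divff// mulr1.
  by rewrite [s + t]addrC addrK.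
apply: sU; first by rewrite ger0_norm ?addr_ge0.
apply: cU => //; first by rewrite divr_ge0// addr_ge0.
by rewrite ler_pdivrMr// mul1r lerDl.
Qed.

Let half_half : 2^-1 + 2^-1 <= 1 :> R.
Proof. by rewrite [leRHS](splitr 1) !mul1r. Qed.

Lemma flc_filter (x : flc V) : ProperFilter (nbhs x).
Proof.
split.
  move=> [U casU /(_ x)] []; exists 0; first exact: cas0.
  by rewrite addr0.
split.
- by exists setT; [exact: casT|].
- move=> A B [U casU UA] [W casW WB]; exists (U `&` W); first exact: casI.
  by move=> _ [u [Uu Wu] <-]; split; [apply: UA|apply: WB]; exists u.
- by move=> A B AB [U casU UA]; exists U => //; apply: subset_trans AB.
Qed.

Lemma flc_singleton (x : flc V) (A : set (flc V)) : nbhs x A -> A x.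
Proof.
by move=> [U /cas0 U0 UA]; apply: UA; exists 0; rewrite ?addr0.
Qed.

Lemma flc_nbhs_nbhs (x : flc V) (A : set (flc V)) :
  nbhs x A -> nbhs x (nbhs^~ A).
Proof.
move=> [U casU UA]; exists [set 2^-1 *: u | u in U].
  exact: cas_scale.
move=> _ [_ [u Uu <-] <-]; exists [set 2^-1 *: u | u in U].
  exact: cas_scale.
move=> _ [_ [v Uv <-] <-]; rewrite -addrA; apply: UA.
exists (2^-1 *: u + 2^-1 *: v) => //.
exact: cas_add.
Qed.

HB.instance Definition _ := Nbhs_isNbhsTopological.Build (flc V)
  flc_filter flc_singleton flc_nbhs_nbhs.

Lemma flc_nbhsP (x : flc V) (A : set (flc V)) : nbhs x A <->
  exists2 U : set V, cas U & [set (x : V) + u | u in U] `<=` A.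
Proof. by []. Qed.

Lemma flc_add_continuous : continuous (fun z : flc V * flc V => z.1 + z.2).
Proof.
move=> [x y] A [U casU UA] /=.
pose W := [set 2^-1 *: u | u in U].
exists ([set (x : V) + u | u in W], [set (y : V) + u | u in W]).
  by split; exists W => //; apply: cas_scale.
move=> [_ _] [/= [_ [u Uu <-] <-] [_ [v Uv <-] <-]]; rewrite /= addrACA.
apply: UA; exists (2^-1 *: u + 2^-1 *: v) => //.
exact: cas_add.
Qed.

Lemma flc_scale_continuous :
  continuous (fun z : R^o * flc V => z.1 *: z.2).
Proof.
move=> [k x] A [U casU UA] /=; have /casP[cU aU sU] := casU.
have [l l0 Ul] := aU x.
pose e := Num.min 1 (l / 2).
have e0 : 0 < e by rewrite lt_min ltr01 divr_gt0.
pose c := (2 * (`|k| + 1))^-1.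
have k1 : 0 < `|k| + 1 by rewrite ltr_wpDl.
have c0 : 0 < c by rewrite invr_gt0 mulr_gt0.
exists (ball (k : R^o) e, [set (x : V) + u | u in [set c *: u | u in U]]).
  split; first exact: nbhsx_ballx.
  by exists [set c *: u | u in U] => //; apply: cas_scale.
move=> [m _] [/= mk [_ [u Uu <-] <-]] /=.
have mkl : `|m - k| <= e.
  by move: mk; rewrite -ball_normE/= distrC => /ltW.
apply: UA; exists ((m - k) *: x + m *: (c *: u)); last first.
  by rewrite scalerDr addrA -scalerDl [k + _]addrC subrK.
have -> : (m - k) *: x + m *: (c *: u) =
    2^-1 *: ((2 * (m - k) / l) *: (l *: x)) + 2^-1 *: ((2 * m * c) *: u).
  rewrite !scalerA; congr (_ *: _ + _ *: _).
    by rewrite mulrA divfK ?gt_eqF// mulrA mulVf// mul1r.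
  by rewrite -!mulrA mulKf.
apply: cas_add => //.
- apply: sU => //; rewrite normrM normrM normfV (gtr0_norm l0).
  rewrite (gtr0_norm (ltr0Sn _ 1)) ler_pdivrMr// mul1r mulrC -ler_pdivlMr//.
  by rewrite (le_trans mkl)// ge_min lexx orbT.
- apply: sU => //; rewrite normrM normrM (gtr0_norm c0).
  rewrite (gtr0_norm (ltr0Sn _ 1)) ler_pdivrMr ?mulr_gt0// mul1r ler_pM2l//.
  rewrite -(subrK k m) (le_trans (ler_normD _ _))// addrC lerD2l.
  by rewrite (le_trans mkl)// ge_min lexx.
Qed.

Lemma flc_locally_convex : exists2 B : set_system (flc V),
  (forall b, b \in B -> convex_set b) & basis B.
Proof.
exists [set b | open b /\ convex_set b]; first by move=> b /set_mem[].
split=> [b []//|x A [U casU UA]].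
pose W := [set z | exists2 t : R, 0 <= t < 1 & [set (x : V) + t *: u | u in U] z].
exists W; last first.
  move=> _ [t /andP[t0 t1] [u Uu <-]]; apply: UA; exists (t *: u) => //.
  have /casP[_ _ sU] := casU; apply: sU => //.
  by rewrite ger0_norm// ltW.
split; last by exists 0; rewrite ?lexx ?ltr01//; exists 0;
  [exact: cas0|rewrite scaler0 addr0].
split.
  rewrite openE => _ [t /andP[t0 t1] [u Uu <-]].
  have s0 : 0 < (1 - t) / 2 by rewrite divr_gt0// subr_gt0.
  exists [set ((1 - t) / 2) *: u | u in U]; first exact: cas_scale.
  move=> _ [_ [v Uv <-] <-].
  pose r := t + (1 - t) / 2.
  have r0 : 0 < r by rewrite ltr_wpDl.
  exists r.
    rewrite ltW//= /r -ltrBrDl ltr_pdivrMr// ltr_pMr ?subr_gt0//.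
    by rewrite ltr1n.
  exists ((t / r) *: u + ((1 - t) / 2 / r) *: v).
    apply: cas_add => //; first exact: divr_ge0 (ltW r0).
      exact: divr_ge0 (ltW s0) (ltW r0).
    by rewrite -mulrDl divff ?gt_eqF.
  by rewrite scalerDr !scalerA !(mulrC r) !divfK ?gt_eqF// addrA.
move=> a b k; rewrite !inE => -[s /andP[s0 s1] [u Uu <-]].
move=> -[t /andP[t0 t1] [v Uv <-]].
pose c : R := k%:num; have c0 : 0 <= c by rewrite /c ge0.
have c1 : 0 <= 1 - c by rewrite subr_ge0 /c le1.
pose r := Num.max s t; have r0 : 0 <= r by rewrite le_max s0.
exists r; first by rewrite r0 gt_max s1.
have avgE : c *: ((x : V) + s *: u) + (1 - c) *: ((x : V) + t *: v) =
    (x : V) + ((c * s) *: u + ((1 - c) * t) *: v).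
  rewrite !scalerDr !scalerA addrACA -scalerDl addrC.
  by rewrite [c + _]addrC subrK scale1r addrC.
have [r00|rn0] := eqVneq r 0.
  have s00 : s = 0 by apply/le_anti; rewrite s0 -r00 le_max lexx.
  have t00 : t = 0 by apply/le_anti; rewrite t0 -r00 le_max lexx orbT.
  exists 0; first exact: cas0.
  by rewrite [RHS]avgE s00 t00 r00 !mulr0 !scale0r !addr0.
have rgt : 0 < r by rewrite lt_neqAle eq_sym rn0.
exists ((c * s / r) *: u + ((1 - c) * t / r) *: v); last first.
  by rewrite [RHS]avgE scalerDr !scalerA !(mulrC r) !divfK.
apply: cas_add => //; [by rewrite !mulr_ge0// invr_ge0..|].
rewrite -mulrDl ler_pdivrMr// mul1r.
apply: (@le_trans _ _ (c * r + (1 - c) * r)).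
  by rewrite lerD// ler_wpM2l// le_max lexx ?orbT.
by rewrite -mulrDl addrC subrK mul1r.
Qed.

HB.instance Definition _ :=
  PreTopologicalNmodule_isTopologicalNmodule.Build (flc V) flc_add_continuous.
HB.instance Definition _ :=
  TopologicalNmodule_isTopologicalLmodule.Build R (flc V) flc_scale_continuous.
(* The factory PreTopologicalLmod_isTvs only provides the uniform structure. *)
HB.instance Definition _ := PreTopologicalLmod_isTvs.Build R (flc V)
  flc_add_continuous flc_scale_continuous flc_locally_convex.
HB.instance Definition _ :=
  Uniform_isTvs.Build R (flc V) flc_locally_convex.

End flc_topology.

Definition seq_closure (T : topologicalType) (C : set T) : set T :=
  [set x | exists2 u : nat -> T, (forall n, C (u n)) & u @ \oo --> x].

Section semiorderings.
Variable A : comNzRingType.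
Implicit Types (I Q : set A).

(* [idealr_closed] includes 1 \notin I; A is commutative, so one-sided ideals
   are two-sided. *)
Definition prime_ideal I : Prop :=
  idealr_closed [in I] /\ prime_idealr_closed [in I].

Definition quadratic_module Q : Prop :=
  [/\ forall p q, Q p -> Q q -> Q (p + q),
      forall f q, Q q -> Q (f ^+ 2 * q)
    & Q 1].

Definition semiordering Q : Prop :=
  [/\ quadratic_module Q,
      Q `|` [set - q | q in Q] = [set: A]
    & prime_ideal (Q `&` [set - q | q in Q])].

End semiorderings.

(* A is the smallest R-subalgebra containing some finite list of elements. *)
Definition finitely_generated_algebra (R : realType) (A : comAlgType R) : Prop :=
  exists gens : seq A, forall S : {pred A},
    GRing.subalg_closed S -> {subset gens <= S} -> forall a, a \in S.

(* Main.v *)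
Require Import Defs.
From HB Require Import structures.
From mathcomp Require Import all_boot all_order all_algebra.
From mathcomp Require Import all_classical all_reals all_analysis.
From mathcomp Require Import ring lra.

Set Implicit Arguments.
Unset Strict Implicit.
Unset Printing Implicit Defensive.

Import Order.TTheory GRing.Theory Num.Theory.
Import numFieldNormedType.Exports.

Local Open Scope classical_set_scope.
Local Open Scope ring_scope.

(** The finest locally convex topology is fine enough that a closure point [f]
    of a semiordering [Q] can be corrected explicitly: some [h], depending on
    [f] but not on [Q], satisfies [f + e *: h \in Q] for every [e > 0].  Since
    the same [h] serves every semiordering, a common closure point of all the
    [Q] in a family is the limit of the sequence [f + h / (n + 1)], whose terms
    lie in the intersection of the family.  Hence
      [\bigcap closure Q `<=` seq_closure (\bigcap Q)],
    and the inclusions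
      [seq_closure (\bigcap Q) `<=` closure (\bigcap Q)
         `<=` \bigcap closure Q]
    hold for any family of sets.

    To find [h], let [p] be 1 plus the sum of the squares of the generators.
    Every [f] grows at most like a power of [p]: for some [c >= 0] and [k], both
    [c p^k + f] and [c p^k - f] lie in every quadratic module
    ([finitely_generated_growth_bound]).  Take [h := p^(k+1)], and let [Q] be a
    semiordering ([closure_semiordering]).
    - If [r - p \in Q] for some real [r], then [Q] is archimedean: powers of
      [p], and so all elements of the algebra, are bounded modulo [Q] by
      constants ([archimedean_of_bound]).  For [e > 0] the set of all [a] with
      [e + a] and [e - a] in [Q] is then a neighborhood of 0, so being in the
      closure of [Q] means that [f + e \in Q] for all [e > 0]
      ([closure_archimedean]); and [p^(k+1) - 1] lies in every quadratic
      module.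
    - Otherwise [p - r \in Q] for all real [r], because [Q] is total.  Taking
      [r = c / e] and multiplying by [e p^k] gives [e p^(k+1) - c p^k \in Q];
      adding [c p^k + f] yields the claim, for any [f] whatsoever. *)

Section multipliers.
Variables (R : realType) (A : comAlgType R).
Implicit Types (Q : set A) (c e r : R) (a b f p q t u x y : A).

Local Notation "c %:S" := (GRing.in_alg A c) (at level 2, format "c %:S").

(** * Sums of squares acting on quadratic modules *)

Lemma scale_in_alg c x : c *: x = c%:S * x.
Proof. by rewrite -mulr_algl. Qed.

(** The multipliers are exactly the sums of squares, since these form a
    quadratic module.  This description makes closure under products immediate,
    and asks for no representation as a sum. *)
Definition multiplier t : Prop :=
  forall Q, quadratic_module Q -> forall q, Q q -> Q (t * q).

Lemma quadratic_module_multiplier Q t :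
  quadratic_module Q -> multiplier t -> Q t.
Proof. by move=> qQ mt; have [_ _ Q1] := qQ; rewrite -[t]mulr1; exact: mt. Qed.

Lemma multiplierD t u : multiplier t -> multiplier u -> multiplier (t + u).
Proof.
move=> mt mu Q qQ q Qq; have [addQ _ _] := qQ.
by rewrite mulrDl; apply: addQ; [exact: mt|exact: mu].
Qed.

Lemma multiplierM t u : multiplier t -> multiplier u -> multiplier (t * u).
Proof.
by move=> mt mu Q qQ q Qq; rewrite -mulrA; apply: mt => //; exact: mu.
Qed.

Lemma multiplier_sqr t : multiplier (t ^+ 2).
Proof. by move=> Q [_ sqrQ _] q Qq; exact: sqrQ. Qed.

Lemma multiplier_const c : 0 <= c -> multiplier c%:S.
Proof.
by move=> c0; rewrite -[c]sqr_sqrtr// rmorphXn; exact: multiplier_sqr.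
Qed.

Lemma multiplier1 : multiplier 1.
Proof. by rewrite -[1](rmorph1 (GRing.in_alg A)); exact: multiplier_const. Qed.

Lemma multiplier0 : multiplier 0.
Proof. by rewrite -[0](rmorph0 (GRing.in_alg A)); exact: multiplier_const. Qed.

Lemma multiplierX t n : multiplier t -> multiplier (t ^+ n).
Proof.
move=> mt; elim: n => [|n IH]; first exact: multiplier1.
by rewrite exprS; exact: multiplierM.
Qed.

Lemma multiplier_half t : multiplier (t + t) -> multiplier t.
Proof.
move=> mt; rewrite (_ : t = (2^-1)%:S * (t + t)).
  by apply: multiplierM => //; exact: multiplier_const.
have h : (2^-1)%:S + (2^-1)%:S = 1 :> A.
  by rewrite -rmorphD -[2^-1]mul1r -splitr rmorph1.
by rewrite mulrDr -mulrDl h mul1r.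
Qed.

Lemma quadratic_module_scale Q c q :
  quadratic_module Q -> 0 <= c -> Q q -> Q (c%:S * q).
Proof. by move=> qQ /multiplier_const; apply. Qed.

Lemma quadratic_moduleD_const Q c r q :
  quadratic_module Q -> c <= r -> Q (c%:S + q) -> Q (r%:S + q).
Proof.
move=> qQ cr Qq; have [addQ _ _] := qQ.
rewrite (_ : _ + q = (r - c)%:S + (c%:S + q)); last by rewrite rmorphB; ring.
apply: addQ => //; apply: (quadratic_module_multiplier qQ).
by apply: multiplier_const; rewrite subr_ge0.
Qed.

(** * The closure of an archimedean quadratic module *)

(** The set [U] of all [a] with [- e <= a <= e] modulo [Q] is convex and
    symmetric, and absorbent because [Q] is archimedean; so [f + U] meets [Q],
    and [e] makes up for the difference between [f] and a point of [Q]. *)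
Lemma closure_archimedean Q f e :
    quadratic_module Q -> (forall a, exists c, Q (c%:S + a)) ->
  closure (Q : set (flc A)) f -> 0 < e -> Q (e%:S + f).
Proof.
move=> qQ archQ clf e0; have [addQ _ _] := qQ.
pose U : set A := [set a | Q (e%:S + a) /\ Q (e%:S - a)].
have convU a b c : 0 <= c -> 0 <= 1 - c -> Q (e%:S + a) -> Q (e%:S + b) ->
    Q (e%:S + (c%:S * a + (1 - c)%:S * b)).
  move=> c0 c1 Qa Qb.
  rewrite (_ : _ + (_ + _) = c%:S * (e%:S + a) + (1 - c)%:S * (e%:S + b)).
    by apply: addQ; exact: (quadratic_module_scale qQ).
  by rewrite rmorphB rmorph1; ring.
have casU : convex_absorbent_symmetric U.
  apply/casP; split.
  - move=> x y c c0 c1 [Qx Qx'] [Qy Qy'].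
    have c1' : 0 <= 1 - c by rewrite subr_ge0.
    rewrite !scale_in_alg.
    split; first exact: convU.
    by rewrite opprD -!mulrN; exact: convU.
  - move=> x; have [c Qc] := archQ x; have [d Qd] := archQ (- x).
    (* The last term only serves to make s positive. *)
    pose s := `|c| + `|d| + 1.
    have s0 : 0 < s by rewrite ltr_wpDl// addr_ge0.
    have cs : c <= s.
      by rewrite /s -addrA (le_trans (ler_norm c))// lerDl addr_ge0.
    have ds : d <= s.
      by rewrite /s addrAC (le_trans (ler_norm d))// lerDr addr_ge0.
    have es : 0 <= e / s by rewrite divr_ge0// ltW.
    exists (e / s); first exact: divr_gt0.
    have E y : e%:S + (e / s)%:S * y = (e / s)%:S * (s%:S + y).
      by rewrite mulrDr -rmorphM divfK ?gt_eqF.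
    rewrite scale_in_alg; split; rewrite -?mulrN E.
      apply: (quadratic_module_scale qQ) => //.
      exact: (quadratic_moduleD_const qQ cs) Qc.
    apply: (quadratic_module_scale qQ) => //.
    exact: (quadratic_moduleD_const qQ ds) Qd.
  - move=> l x l1 [Qx Qx']; move: l1; rewrite ler_norml => /andP[l1 l2].
    (* l *: x is a convex combination of x and - x. *)
    have c0 : 0 <= (1 + l) / 2 by lra.
    have c1 : 0 <= 1 - (1 + l) / 2 by lra.
    have E : l%:S = ((1 + l) / 2)%:S - (1 - (1 + l) / 2)%:S :> A.
      by rewrite -rmorphB; congr (_%:S); field.
    have Q1 := convU _ _ _ c0 c1 Qx Qx'.
    have Q2 : Q (e%:S + - x) -> Q (e%:S - - x) -> Q (e%:S - l%:S * x).
      move=> P1 P2; have := convU _ _ _ c0 c1 P1 P2.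
      by rewrite E; congr (Q _); ring.
    rewrite scale_in_alg; split; last by apply: Q2; rewrite ?opprK.
    by move: Q1; rewrite E; congr (Q _); ring.
have [|g [Qg [u [_ Qu] ug]]] := clf [set (f : A) + u | u in U].
  by exists U.
rewrite (_ : _ + f = (e%:S - u) + g); first exact: addQ.
by rewrite -ug; ring.
Qed.

Lemma semiordering_total Q a : semiordering Q -> Q a \/ Q (- a).
Proof.
move=> [_ /seteqP[_ /(_ a I)] [Qa|[q Qq <-]] _]; [by left|right].
by rewrite opprK.
Qed.

(** * Growth bounds by powers of a fixed element *)

(** The bound is required in the strong form of multipliers, rather than of
    membership in all quadratic modules, so that bounds can be multiplied. *)
Definition growth_bound p f : Prop := exists c k,
  [/\ 0 <= c, multiplier (c%:S * p ^+ k + f) & multiplier (c%:S * p ^+ k - f)].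

Section growth.
Variable p : A.
Hypotheses (mp : multiplier p) (mp1 : multiplier (p - 1)).

Lemma multiplier_expB k m : (k <= m)%N -> multiplier (p ^+ m - p ^+ k).
Proof.
move=> /subnK <-; elim: (m - k)%N => [|n IH].
  by rewrite subrr; exact: multiplier0.
rewrite (_ : _ - _ = p ^+ (n + k) * (p - 1) + (p ^+ (n + k) - p ^+ k)).
  by apply: multiplierD IH; apply: multiplierM => //; exact: multiplierX.
by rewrite addSn exprS; ring.
Qed.

Lemma multiplier_leX c k m f : 0 <= c -> (k <= m)%N ->
  multiplier (c%:S * p ^+ k + f) -> multiplier (c%:S * p ^+ m + f).
Proof.
move=> c0 km mf.
rewrite (_ : _ + f = c%:S * (p ^+ m - p ^+ k) + (c%:S * p ^+ k + f)).
  apply: multiplierD mf; apply: multiplierM; first exact: multiplier_const.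
  exact: multiplier_expB.
by ring.
Qed.

Lemma growth_bound_const c : growth_bound p c%:S.
Proof.
exists `|c|, 0%N; rewrite expr0 mulr1 -rmorphD -rmorphB; split=> //.
  by apply: multiplier_const; rewrite -lerBlDr sub0r -normrN ler_norm.
by apply: multiplier_const; rewrite subr_ge0 ler_norm.
Qed.

Lemma growth_boundD f g :
  growth_bound p f -> growth_bound p g -> growth_bound p (f + g).
Proof.
move=> [c [k [c0 f1 f2]]] [d [l [d0 g1 g2]]].
exists (c + d), (maxn k l); rewrite rmorphD/= mulrDl opprD; split.
- exact: addr_ge0.
- by rewrite addrACA; apply: multiplierD;
    [exact: multiplier_leX c0 (leq_maxl k l) f1
    |exact: multiplier_leX d0 (leq_maxr k l) g1].
- by rewrite addrACA; apply: multiplierD;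
    [exact: multiplier_leX c0 (leq_maxl k l) f2
    |exact: multiplier_leX d0 (leq_maxr k l) g2].
Qed.

(** If [- a <= f <= a] and [- b <= g <= b], then [2 (a b + f g)] and
    [2 (a b - f g)] are sums of two products of nonnegative factors. *)
Lemma growth_boundM f g :
  growth_bound p f -> growth_bound p g -> growth_bound p (f * g).
Proof.
move=> [c [k [c0 f1 f2]]] [d [l [d0 g1 g2]]].
exists (c * d), (k + l)%N; rewrite rmorphM/= exprD.
have E : c%:S * d%:S * (p ^+ k * p ^+ l) = (c%:S * p ^+ k) * (d%:S * p ^+ l).
  by ring.
rewrite E; move: (c%:S * _) (d%:S * _) f1 f2 g1 g2 => a b f1 f2 g1 g2.
split; first exact: mulr_ge0.
  apply: multiplier_half.
  rewrite (_ : a * b + f * g + _ =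
    (a + f) * (b + g) + (a - f) * (b - g)); last by ring.
  by apply: multiplierD; exact: multiplierM.
apply: multiplier_half.
rewrite (_ : a * b - f * g + _ =
    (a + f) * (b - g) + (a - f) * (b + g)); last by ring.
by apply: multiplierD; exact: multiplierM.
Qed.

(** * The closure of a semiordering *)

(** From [c - p \in Q] it follows by induction that [c^n - p^n \in Q], as [Q] is
    stable under multiplication by [p]; so a bound by a power of [p] becomes a
    bound by a constant. *)
Lemma archimedean_of_bound Q f c :
    quadratic_module Q -> Q (c%:S - p) -> growth_bound p f ->
  exists d, Q (d%:S + f).
Proof.
move=> qQ Qc [d [k [d0 mf _]]]; have [addQ _ _] := qQ.
have {Qc} := quadratic_moduleD_const qQ (ler_norm c) Qc.
move: `|c| (normr_ge0 c) => {}c c0 Qc.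
have powQ n : Q ((c ^+ n)%:S - p ^+ n).
  elim: n => [|n IH].
    rewrite !expr0 rmorph1 subrr.
    by apply: (quadratic_module_multiplier qQ); exact: multiplier0.
  rewrite (_ : _ - _ = c%:S * ((c ^+ n)%:S - p ^+ n) + p ^+ n * (c%:S - p)).
    apply: addQ; first exact: (quadratic_module_scale qQ).
    exact: (multiplierX n mp).
  by rewrite !exprS rmorphM; ring.
exists (d * c ^+ k).
rewrite (_ : _ + f = d%:S * ((c ^+ k)%:S - p ^+ k) + (d%:S * p ^+ k + f)).
  apply: addQ; first exact: (quadratic_module_scale qQ).
  exact: (quadratic_module_multiplier qQ).
by rewrite rmorphM; ring.
Qed.

(** The correction term depends on [f] alone.  When [Q] is not archimedean, it
    corrects every [f], so that [Q] is dense. *)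
Lemma closure_semiordering Q f c k :
    (forall g, growth_bound p g) -> semiordering Q ->
    0 <= c -> multiplier (c%:S * p ^+ k + f) ->
    closure (Q : set (flc A)) f ->
  forall e, 0 < e -> Q (f + e%:S * p ^+ k.+1).
Proof.
move=> bndp sQ c0 mf clf e e0; have [qQ _ _] := sQ; have [addQ _ _] := qQ.
(* Either p is bounded modulo Q, or it exceeds all constants modulo Q. *)
have [[r Qr]|nQ] := pselect (exists r, Q (r%:S - p)).
  have archQ g : exists d, Q (d%:S + g) by exact: archimedean_of_bound Qr _.
  have Qe := closure_archimedean qQ archQ clf e0.
  rewrite (_ : _ + _ = e%:S * (p ^+ k.+1 - p ^+ 0) + (e%:S + f)).
    apply: addQ => //; apply: (quadratic_module_scale qQ); first exact: ltW.
    by apply: (quadratic_module_multiplier qQ); exact: multiplier_expB.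
  by rewrite expr0; ring.
have Qce : Q (p - (c / e)%:S).
  have [Qce|] := semiordering_total (p - (c / e)%:S) sQ; first by [].
  by rewrite opprB => Qce; exfalso; apply: nQ; exists (c / e).
have ec : e%:S * (c / e)%:S = c%:S :> A by rewrite -rmorphM mulrC divfK ?gt_eqF.
rewrite (_ : _ + _ =
    e%:S * (p ^+ k * (p - (c / e)%:S)) + (c%:S * p ^+ k + f)).
  apply: addQ; last exact: (quadratic_module_multiplier qQ).
  apply: (quadratic_module_scale qQ) => //; first exact: ltW.
  exact: (multiplierX k mp).
by rewrite -ec exprS; ring.
Qed.

End growth.

(** The elements with a growth bound form a subalgebra, so the generators are
    enough; for [y = x] or [y = - x] with [x] a generator,
    [2 (1 + y^2 + y) = (y + 1)^2 + y^2 + 1] is a sum of squares. *)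
Lemma finitely_generated_growth_bound : finitely_generated_algebra A ->
  exists p, [/\ multiplier p, multiplier (p - 1) & forall f, growth_bound p f].
Proof.
move=> [gens genA].
have msum (s : seq A) : multiplier (\sum_(x <- s) x ^+ 2).
  elim: s => [|x s IH]; first by rewrite big_nil; exact: multiplier0.
  by rewrite big_cons; apply: multiplierD => //; exact: multiplier_sqr.
pose p := 1 + \sum_(x <- gens) x ^+ 2.
have mp1 : multiplier (p - 1) by rewrite /p addrAC subrr add0r.
have mp : multiplier p by apply: multiplierD => //; exact: multiplier1.
exists p; split=> // f.
suff : f \in [pred g | `[< growth_bound p g >]] by move/asboolP.
apply: genA => [|x xs].
  split.
  - by apply/asboolP; rewrite -[1](rmorph1 (GRing.in_alg A));
      exact: growth_bound_const.
  - move=> c u v /asboolP bu /asboolP bv; apply/asboolP.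
    apply: growth_boundD => //; rewrite scale_in_alg.
    by apply: growth_boundM => //; exact: growth_bound_const.
  - move=> u v /asboolP bu /asboolP bv; apply/asboolP.
    exact: growth_boundM.
have mpx y : y ^+ 2 = x ^+ 2 -> multiplier (p + y).
  move=> yx; apply: multiplier_half.
  rewrite /p (big_rem x)//= -yx.
  move: (\sum_(z <- _) _) (msum (rem x gens)) => s ms.
  rewrite (_ : 1 + (y ^+ 2 + s) + y + _ =
    (y + 1) ^+ 2 + y ^+ 2 + 1 + (s + s)); last by ring.
  by do !apply: multiplierD => //;
    [exact: multiplier_sqr|exact: multiplier_sqr|exact: multiplier1].
apply/asboolP; exists 1, 1%N; rewrite rmorph1 mul1r expr1; split=> //.
  exact: mpx.
by apply: mpx; rewrite sqrrN.
Qed.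

End multipliers.

(** * Sequences in the finest locally convex topology *)

Lemma flc_cvg_line (R : realType) (V : lmodType R) (x h : V) :
  (fun n : nat => x + n.+1%:R^-1 *: h : flc V) @ \oo --> (x : flc V).
Proof.
move=> B [U /casP[_ aU sU] UB]; have [l l0 Ul] := aU h.
have := @cvg_harmonic R.
move=> /cvgrPdist_le/(_ l l0); apply: filterS => n.
rewrite sub0r normrN => nl.
apply: UB; exists (n.+1%:R^-1 *: h) => //.
rewrite (_ : _ *: h = (n.+1%:R^-1 / l) *: (l *: h)).
  apply: sU => //; rewrite normrM [`|l^-1|]gtr0_norm ?invr_gt0//.
  by rewrite ler_pdivrMr// mul1r.
by rewrite scalerA divfK ?gt_eqF.
Qed.

Lemma seq_closure_subset_closure (T : topologicalType) (C : set T) :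
  seq_closure C `<=` closure C.
Proof.
move=> x [u Cu ux] B /ux [n _ uB]; exists (u n); split=> //.
exact: uB (leqnn n).
Qed.

Theorem proposition2p3 (R : realType) (A : comAlgType R)
    (hA : finitely_generated_algebra A)
    (Y : set (set A)) (hY : forall Q : set A, Y Q -> semiordering Q) :
  let C : set (flc A) := \bigcap_(Q in Y) Q in
  seq_closure C = closure C
  /\ closure C = \bigcap_(Q in Y) closure (Q : set (flc A)).
Proof.
move=> C.
have sub1 : seq_closure C `<=` closure C by exact: seq_closure_subset_closure.
have sub2 : closure C `<=` \bigcap_(Q in Y) closure (Q : set (flc A)).
  by move=> f Cf Q YQ; apply: closure_subset Cf; exact: bigcap_inf.
have sub3 : \bigcap_(Q in Y) closure (Q : set (flc A)) `<=` seq_closure C.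
  move=> f clf; have [p [mp mp1 bndp]] := finitely_generated_growth_bound hA.
  have [c [k [c0 mf _]]] := bndp f.
  exists (fun n => f + n.+1%:R^-1 *: (p ^+ k.+1 : A)).
    move=> n Q YQ; rewrite scale_in_alg.
    by apply: (closure_semiordering mp mp1 bndp (hY _ YQ) c0 mf (clf _ YQ)).
  exact: flc_cvg_line.
by split; apply/seteqP; split=> //; [exact: subset_trans sub3|
  exact: subset_trans sub3 sub1].
Qed.
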